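(* For every integer $k\ge 1$, $$\left|\frac{R(k)}{k}-c_k\right|\le \frac{3\sqrt{\pi}}{16}\,k^{-3/2}+\frac{27}{2}e^{-3}k^{-2}+\frac{\sqrt{\pi}}{144}\,k^{-5/2}+128\,e^{-4}k^{-3}.$$
   Context: Let $\zeta$ denote the Riemann zeta function. For integers $k\ge 0$ define $$c_k=\sum_{j=0}^k (-1)^j\binom{k}{j}\frac{1}{\zeta(2j+2)}.$$ For real $x$ define the Riesz function (an everywhere convergent power series) $$R(x)=\sum_{k=1}^\infty \frac{(-1)^{k+1}x^k}{(k-1)!\,\zeta(2k)}=x\sum_{k=0}^\infty\frac{(-1)^k x^k}{k!\,\zeta(2k+2)}.$$ *)

(* Defs.v *)
From Stdlib Require Import Arith Reals.
From Coquelicot Require Import Coquelicot.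
Open Scope R_scope.

(* The Riemann zeta function on the real half-line s > 1, where it is given by
   its Dirichlet series; the value at s <= 1 is not meaningful. *)
Definition zeta (s : R) : R := Series (fun n : nat => / Rpower (INR (n + 1)) s).

(* [Binomial.C] is the real-valued binomial coefficient; plain [C] would be
   Coquelicot's complex numbers.  [sum_f_R0 f k] is f 0 + ... + f k. *)
Definition c (k : nat) : R :=
  sum_f_R0 (fun j => (-1) ^ j * Binomial.C k j * (1 / zeta (INR (2 * j + 2)))) k.

Definition Riesz (x : R) : R :=
  x * PSeries (fun k => (-1) ^ k / (INR (fact k) * zeta (INR (2 * k + 2)))) x.

(* Main.v *)
Require Import Defs.
From Stdlib Require Import Arith Reals ZArith Znumtheory Lia Lra Classical.
From Coquelicot Require Import Coquelicot.
Open Scope R_scope.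

(** The Moebius expansion of [1 / zeta (2 j + 2)] turns both sides into sums
    over [n] with the same coefficients, and summing over [j] gives
    [c k = sum mu(n) n^-2 (1 - n^-2)^k] and
    [R(k) / k = sum mu(n) n^-2 exp (- k n^-2)] ([inv_zeta], [c_truncate],
    [Riesz_truncate]).  Since [|mu| <= 1], the difference is at most
    [sum_n H(n^-2)], where [H x = x (exp (- k x) - (1 - x)^k)] is nonnegative
    on [0, 1].

    The function [H] rises and then falls on [0, 1].  Hence the sum exceeds the
    corresponding integral by at most the maximum of [H]
    ([psum_weighted_le]).  With [u = 1 / n] as variable, that integral is
    [int_0^1 (exp (- k u^2) - (1 - u^2)^k) du].

    The maximum gives the terms in [k^-2] and [k^-3]: from
    [exp x >= 1 + x + x^2 / 2] and Bernoulli's inequality,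
    [H x <= (k / 2) (x^3 + x^4) exp (- k x)], and [v^m exp (- v)] is largest at
    [v = m] ([weighted_le_peak]).

    The integral gives the term in [k^-3/2]: its Gaussian part is at most
    [sqrt PI / (2 sqrt k)] ([gaussian_upper]), its Wallis part
    is at least [sqrt PI / (2 sqrt k) (1 - 3 / (8 k))] ([wallis_lower]), and the
    difference of these two is exactly [3 sqrt PI / 16 k^-3/2].

    All infinite sums are cut at [N] terms with an error of order [1 / N], so
    that sums can be exchanged freely, and [N] is sent to infinity at the end. *)

(** * Sums of the first terms of a series *)

(** This is how every limit [N -> infinity] is taken below. *)
Lemma le_of_forall_div (x y K : R) :
  (forall n, (1 <= n)%nat -> x <= y + K / INR n) -> x <= y.
Proof.
  intros H. apply Rnot_lt_le; intros Hlt.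
  destruct (INR_unbounded (K / (x - y))) as [n Hn].
  assert (Hd : 0 < x - y) by lra.
  assert (Hn' : K / (x - y) < INR (S n)) by (rewrite S_INR; lra).
  specialize (H (S n) ltac:(lia)).
  assert (Hp : 0 < INR (S n)) by (apply lt_0_INR; lia).
  apply (Rmult_lt_compat_r (x - y)) in Hn'; [|exact Hd].
  replace (K / (x - y) * (x - y)) with K in Hn' by (field; lra).
  apply (Rmult_le_compat_r (INR (S n))) in H; [|lra].
  replace ((y + K / INR (S n)) * INR (S n)) with (y * INR (S n) + K) in H by (field; lra).
  nra.
Qed.

(** Coquelicot's [sum_n f n] has [n + 1] terms; here [n] is the number of terms, so
    that [psum f (p * M)] splits into [M] blocks of length [p]. *)
Fixpoint psum (f : nat -> R) (n : nat) : R :=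
  match n with O => 0 | S m => psum f m + f m end.

Lemma psum_sum_n f n : psum f (S n) = sum_n f n.
Proof.
  induction n as [|n IH].
  - rewrite sum_O. simpl. lra.
  - rewrite sum_Sn, <- IH. reflexivity.
Qed.

Lemma psum_ext f g n : (forall i, (i < n)%nat -> f i = g i) -> psum f n = psum g n.
Proof.
  induction n as [|n IH]; intros H; simpl; [reflexivity|].
  rewrite IH, H by (intros; try apply H; lia). reflexivity.
Qed.

Lemma psum_scal f a n : psum (fun i => a * f i) n = a * psum f n.
Proof. induction n as [|n IH]; simpl; [|rewrite IH]; ring. Qed.

Lemma psum_Rabs_le f g n :
  (forall i, (i < n)%nat -> Rabs (f i) <= g i) -> Rabs (psum f n) <= psum g n.
Proof.
  induction n as [|n IH]; intros H; simpl.
  - rewrite Rabs_R0. lra.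
  - eapply Rle_trans; [apply Rabs_triang|].
    apply Rplus_le_compat; [apply IH; intros; apply H; lia | apply H; lia].
Qed.

Lemma is_lim_seq_psum f l : is_series f l -> is_lim_seq (psum f) l.
Proof.
  intros H. apply is_lim_seq_incr_1.
  apply is_lim_seq_ext with (sum_n f); [|exact H].
  intros n. symmetry. apply psum_sum_n.
Qed.

Lemma is_series_telescope (N : nat) : (1 <= N)%nat ->
  is_series (fun k => / INR (N + k) - / INR (N + S k)) (/ INR N).
Proof.
  intros HN.
  assert (E : forall n, sum_n (fun k => / INR (N + k) - / INR (N + S k)) n
               = / INR N - / INR (N + S n)).
  { induction n as [|n IH].
    - rewrite sum_O. rewrite Nat.add_0_r. reflexivity.
    - rewrite sum_Sn, IH. unfold plus; simpl plus. simpl. ring. }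
  change (is_lim_seq (sum_n (fun k => / INR (N + k) - / INR (N + S k))) (/ INR N)).
  apply is_lim_seq_ext with (fun n => / INR N - / INR (N + S n)).
  { intros; symmetry; apply E. }
  replace (Finite (/ INR N)) with (Finite (/ INR N - 0)) by (f_equal; ring).
  apply is_lim_seq_minus'; [apply is_lim_seq_const|].
  apply is_lim_seq_ext with (fun n => / INR (n + (N + 1))).
  { intros n. do 2 f_equal. lia. }
  apply (is_lim_seq_incr_n (fun n => / INR n)).
  replace (Finite 0) with (Rbar_inv p_infty) by reflexivity.
  apply is_lim_seq_inv; [apply is_lim_seq_INR | discriminate].
Qed.

(** [1 / n^2 <= 1 / (n - 1) - 1 / n] bounds the tail by a telescoping series. *)
Lemma inverse_square_tail (b : nat -> R) (B : R) :
  (forall n, Rabs (b n) <= B / INR (S n) ^ 2) ->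
  ex_series b /\
  forall N, (1 <= N)%nat -> Rabs (Series b - psum b N) <= B / INR N.
Proof.
  intros Hb.
  assert (HB : 0 <= B).
  { specialize (Hb O). simpl in Hb.
    assert (0 <= Rabs (b O)) by apply Rabs_pos. lra. }
  assert (Hk : forall N k, (1 <= N)%nat ->
            Rabs (b (N + k)%nat) <= B * (/ INR (N + k) - / INR (N + S k))).
  { intros N k HN. eapply Rle_trans; [apply Hb|].
    replace (N + S k)%nat with (S (N + k)) by lia.
    assert (Hp : 0 < INR (N + k)) by (apply lt_0_INR; lia).
    rewrite S_INR. unfold Rdiv. apply Rmult_le_compat_l; [exact HB|].
    apply Rle_trans with (/ (INR (N + k) * (INR (N + k) + 1))).
    - apply Rinv_le_contravar; nra.
    - apply Req_le. field. lra. }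
  assert (Hs : forall N, (1 <= N)%nat ->
     is_series (fun k => B * (/ INR (N + k) - / INR (N + S k))) (B / INR N)).
  { intros N HN.
    exact (is_series_scal B _ _ (is_series_telescope N HN)). }
  assert (Ha : forall N, (1 <= N)%nat -> ex_series (fun k => Rabs (b (N + k)%nat))).
  { intros N HN.
    apply (ex_series_le (K := R_AbsRing) (V := R_CompleteNormedModule) _
             (fun k => B * (/ INR (N + k) - / INR (N + S k)))).
    - intros n. change (Rabs (Rabs (b (N + n)%nat)) <= B * (/ INR (N + n) - / INR (N + S n))).
      rewrite Rabs_Rabsolu. apply Hk, HN.
    - exists (B / INR N). apply Hs, HN. }
  assert (Ex : ex_series b).
  { apply ex_series_incr_1. apply ex_series_Rabs. apply (Ha 1%nat). lia. }
  split; [exact Ex|].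
  intros N HN.
  rewrite (Series_incr_n b N) by (try lia; exact Ex).
  rewrite <- sum_n_Reals, <- psum_sum_n.
  replace (S (Init.Nat.pred N)) with N by lia.
  replace (psum b N + Series (fun k => b (N + k)%nat) - psum b N)
    with (Series (fun k => b (N + k)%nat)) by ring.
  eapply Rle_trans; [apply Series_Rabs, Ha, HN|].
  rewrite <- (is_series_unique _ _ (Hs N HN)).
  apply Series_le.
  - intros n. split; [apply Rabs_pos | apply Hk, HN].
  - exists (B / INR N). apply Hs, HN.
Qed.

(** * The Dirichlet series of the Moebius function *)

(** The Dirichlet series of [a] starts with the coefficient [a 1], hence the shift. *)
Definition dterm (a : nat -> R) (s n : nat) : R := a (S n) / INR (S n) ^ s.
Definition dseries (a : nat -> R) (s : nat) : R := Series (dterm a s).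

Lemma dseries_tail (a : nat -> R) (B : R) (s : nat) :
  (2 <= s)%nat -> (forall n, (1 <= n)%nat -> Rabs (a n) <= B) ->
  ex_series (dterm a s) /\
  forall N, (1 <= N)%nat -> Rabs (dseries a s - psum (dterm a s) N) <= B / INR N.
Proof.
  intros Hs Ha. apply inverse_square_tail. intros n. unfold dterm.
  assert (H1 : 1 <= INR (S n)) by (rewrite S_INR; generalize (pos_INR n); lra).
  assert (H2 : INR (S n) ^ 2 <= INR (S n) ^ s) by (apply Rle_pow; assumption).
  assert (H3 : 0 < INR (S n) ^ 2) by nra.
  unfold Rdiv. rewrite Rabs_mult. rewrite (Rabs_right (/ _)).
  - apply Rmult_le_compat.
    + apply Rabs_pos.
    + apply Rlt_le, Rinv_0_lt_compat; lra.
    + apply Ha. lia.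
    + apply Rinv_le_contravar; assumption.
  - apply Rle_ge, Rlt_le, Rinv_0_lt_compat; lra.
Qed.

(** On Dirichlet series this is multiplication by the Euler factor [1 - p^-s]. *)
Definition strike (p : nat) (a : nat -> R) (n : nat) : R :=
  a n - (if (n mod p =? 0)%nat then a (n / p)%nat else 0).

(** In each block of [p] consecutive integers only the last one is a multiple
    of [p]. *)
Lemma psum_multiples (p : nat) (a : nat -> R) (s M : nat) :
  (2 <= p)%nat ->
  psum (dterm (fun n => if (n mod p =? 0)%nat then a (n / p)%nat else 0) s) (p * M)
  = / INR p ^ s * psum (dterm a s) M.
Proof.
  intros Hp. set (f := dterm _ s).
  assert (Hp0 : 0 < INR p) by (apply lt_0_INR; lia).
  induction M as [|M IH].
  - rewrite Nat.mul_0_r. simpl. ring.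
  - assert (Hblock : forall j, (j < p)%nat -> psum f (p * M + j) = psum f (p * M)).
    { induction j as [|j IHj]; intros Hj.
      - now rewrite Nat.add_0_r.
      - rewrite Nat.add_succ_r. simpl psum. rewrite IHj by lia.
        unfold f at 2, dterm.
        replace (S (p * M + j)) with (S j + M * p)%nat by lia.
        rewrite Nat.Div0.mod_add, Nat.mod_small by lia.
        simpl Nat.eqb. unfold Rdiv. ring. }
    replace (p * S M)%nat with (S (p * M + (p - 1))) by lia.
    simpl psum at 1. rewrite Hblock by lia. rewrite IH.
    unfold f, dterm at 2.
    replace (S (p * M + (p - 1))) with (S M * p)%nat by lia.
    rewrite Nat.Div0.mod_mul, Nat.div_mul by lia. simpl Nat.eqb.
    rewrite mult_INR, Rpow_mult_distr. simpl psum.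
    unfold dterm at 3.
    assert (INR (S M) <> 0) by (apply not_0_INR; lia).
    field. split; apply pow_nonzero; lra.
Qed.

Lemma dseries_strike (p : nat) (a : nat -> R) (B : R) (s : nat) :
  (2 <= p)%nat -> (2 <= s)%nat -> (forall n, (1 <= n)%nat -> Rabs (a n) <= B) ->
  dseries (strike p a) s = (1 - / INR p ^ s) * dseries a s.
Proof.
  intros Hp Hs Ha.
  assert (HB : 0 <= B).
  { specialize (Ha 1%nat ltac:(lia)). generalize (Rabs_pos (a 1%nat)). lra. }
  set (m := fun n => if (n mod p =? 0)%nat then a (n / p)%nat else 0).
  assert (Hm : forall n, (1 <= n)%nat -> Rabs (m n) <= B).
  { intros n Hn. unfold m. destruct (Nat.eqb_spec (n mod p) 0) as [E|E].
    - apply Ha. apply Nat.div_le_lower_bound; [lia|].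
      assert (p <= n)%nat; [|lia].
      apply Nat.nlt_ge; intros Hl. rewrite Nat.mod_small in E; lia.
    - rewrite Rabs_R0. exact HB. }
  destruct (dseries_tail a B s Hs Ha) as [Ea _].
  destruct (dseries_tail m B s Hs Hm) as [Em _].
  assert (Eq : dseries m s = / INR p ^ s * dseries a s).
  { assert (L1 : is_lim_seq (fun M => psum (dterm m s) (p * M)) (dseries m s)).
    { apply is_lim_seq_subseq.
      - apply eventually_subseq. intros n. lia.
      - apply is_lim_seq_psum. apply Series_correct, Em. }
    assert (L2 : is_lim_seq (fun M => psum (dterm m s) (p * M)) (/ INR p ^ s * dseries a s)).
    { apply is_lim_seq_ext with (fun M => / INR p ^ s * psum (dterm a s) M).
      - intros M. symmetry. apply psum_multiples, Hp.
      - apply (is_lim_seq_scal_l _ (/ INR p ^ s) (Finite (dseries a s))).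
        apply is_lim_seq_psum. apply Series_correct, Ea. }
    apply is_lim_seq_unique in L1. apply is_lim_seq_unique in L2.
    rewrite L1 in L2. now injection L2. }
  replace ((1 - / INR p ^ s) * dseries a s) with (dseries a s - dseries m s)
    by (rewrite Eq; ring).
  unfold dseries. rewrite <- Series_minus by assumption.
  apply Series_ext. intros n. unfold dterm, strike, m, Rdiv. ring.
Qed.

Fixpoint sieve (a : nat -> R) (r : nat) : nat -> R :=
  match r with
  | O => a
  | S r' => if prime_dec (Z.of_nat r) then strike r (sieve a r') else sieve a r'
  end.

Lemma sieve_bounded (a : nat -> R) (B : R) (r : nat) :
  (forall n, (1 <= n)%nat -> Rabs (a n) <= B) ->
  exists B', forall n, (1 <= n)%nat -> Rabs (sieve a r n) <= B'.
Proof.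
  intros Ha. induction r as [|r [B' IH]]; [now exists B|].
  assert (HB : 0 <= B').
  { specialize (IH 1%nat ltac:(lia)). generalize (Rabs_pos (sieve a r 1%nat)). lra. }
  cbn [sieve]. destruct (prime_dec _) as [P|P]; [|now exists B'].
  exists (B' + B'). intros n Hn. unfold strike.
  eapply Rle_trans; [apply Rabs_triang|]. rewrite Rabs_Ropp.
  apply Rplus_le_compat; [apply IH, Hn|].
  destruct (Nat.eqb_spec (n mod S r) 0) as [E|E].
  - apply IH. apply Nat.div_le_lower_bound; [lia|].
    assert (S r <= n)%nat; [|lia].
    apply Nat.nlt_ge; intros Hl. rewrite Nat.mod_small in E; lia.
  - rewrite Rabs_R0. exact HB.
Qed.

(** Sieving multiplies a Dirichlet series by a factor that depends only on the
    primes struck, not on the coefficients; comparing two series avoids naming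
    that factor. *)
Lemma dseries_sieve_cross (a b : nat -> R) (A B : R) (s r : nat) :
  (2 <= s)%nat ->
  (forall n, (1 <= n)%nat -> Rabs (a n) <= A) ->
  (forall n, (1 <= n)%nat -> Rabs (b n) <= B) ->
  dseries (sieve a r) s * dseries b s = dseries (sieve b r) s * dseries a s.
Proof.
  intros Hs Ha Hb. induction r as [|r IH]; [simpl; ring|].
  cbn [sieve]. destruct (prime_dec _) as [P|P]; [|exact IH].
  destruct (sieve_bounded a A r Ha) as [A' HA'].
  destruct (sieve_bounded b B r Hb) as [B' HB'].
  assert (2 <= S r)%nat by (apply prime_ge_2 in P; lia).
  rewrite (dseries_strike _ _ A') by assumption.
  rewrite (dseries_strike _ _ B') by assumption.
  rewrite !Rmult_assoc, IH. reflexivity.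
Qed.

Definition prime_divides (q n : nat) : Prop := prime (Z.of_nat q) /\ (Z.of_nat q | Z.of_nat n)%Z.

Lemma prime_divides_mul (q r m : nat) :
  prime (Z.of_nat r) -> prime_divides q (r * m) -> q = r \/ prime_divides q m.
Proof.
  intros Pr [Pq D]. rewrite Nat2Z.inj_mul in D.
  destruct (prime_mult _ Pq _ _ D) as [D'|D'].
  - left. apply prime_div_prime in D'; auto. lia.
  - right. now split.
Qed.

Lemma exists_prime_divides (n : nat) : (2 <= n)%nat -> exists q, prime_divides q n.
Proof.
  induction n as [n IH] using (well_founded_induction lt_wf). intros Hn.
  destruct (prime_dec (Z.of_nat n)) as [P|P].
  - exists n. split; [exact P | apply Z.divide_refl].
  - destruct (not_prime_divide (Z.of_nat n) ltac:(lia) P) as [d [Hd D]].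
    destruct (IH (Z.to_nat d) ltac:(lia) ltac:(lia)) as [q [Pq Dq]].
    exists q. split; [exact Pq|]. rewrite Z2Nat.id in Dq by lia.
    eapply Z.divide_trans; eassumption.
Qed.

Lemma prime_divides_le (q n : nat) : (1 <= n)%nat -> prime_divides q n -> (q <= n)%nat.
Proof. intros Hn [_ D]. apply Z.divide_pos_le in D; lia. Qed.

Lemma mod_eq_0_prime_divides (r n : nat) : prime (Z.of_nat r) ->
  (n mod r = 0)%nat <-> prime_divides r n.
Proof.
  intros P. assert (r <> 0)%nat by (apply prime_ge_2 in P; lia).
  rewrite Nat.Lcm0.mod_divide. split.
  - intros [k ->]. split; [exact P|]. exists (Z.of_nat k). lia.
  - intros [_ [k Hk]]. exists (Z.to_nat k).
    assert (0 <= k)%Z by nia. nia.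
Qed.

(** The sieve of Eratosthenes: striking the primes up to [r] from [zeta] removes
    every [n] with a prime factor at most [r]. *)
Lemma sieve_one (r n : nat) : (1 <= n)%nat ->
  ((exists q, (q <= r)%nat /\ prime_divides q n) -> sieve (fun _ => 1) r n = 0) /\
  (~ (exists q, (q <= r)%nat /\ prime_divides q n) -> sieve (fun _ => 1) r n = 1).
Proof.
  revert n. induction r as [|r IH]; intros n Hn.
  - split; [|reflexivity]. intros (q & Hq & [P _]).
    apply prime_ge_2 in P. lia.
  - assert (Hle : forall q m, (q <= S r)%nat -> prime_divides q m ->
              q = S r \/ (exists q, (q <= r)%nat /\ prime_divides q m)).
    { intros q m Hq D. destruct (Nat.eq_dec q (S r)); [now left|right].
      exists q. split; [lia|exact D]. }
    cbn [sieve]. destruct (prime_dec _) as [P|P].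
    + unfold strike. destruct (Nat.eqb_spec (n mod S r) 0) as [E|E].
      * assert (D : prime_divides (S r) n) by now apply mod_eq_0_prime_divides.
        split; [intros _ | intros H; exfalso; apply H; exists (S r); split; [lia|exact D]].
        set (m := (n / S r)%nat).
        assert (En : n = (S r * m)%nat).
        { generalize (Nat.div_mod_eq n (S r)). unfold m. lia. }
        assert (Hm : (1 <= m)%nat) by nia.
        destruct (IH n Hn) as [N0 N1]. destruct (IH m Hm) as [M0 M1].
        destruct (classic (exists q, (q <= r)%nat /\ prime_divides q m)) as [C|C].
        -- rewrite (M0 C), N0; [ring|].
           destruct C as (q & Hq & Pq & Dq). exists q. split; [exact Hq|].
           split; [exact Pq|]. rewrite En, Nat2Z.inj_mul. now apply Z.divide_mul_r.
        -- rewrite (M1 C), N1; [ring|]. intros (q & Hq & Dq). apply C.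
           rewrite En in Dq. apply prime_divides_mul in Dq as [->|Dq]; [lia| |exact P].
           exists q. now split.
      * destruct (IH n Hn) as [N0 N1]. split; intros H.
        -- rewrite N0; [ring|]. destruct H as (q & Hq & Dq).
           destruct (Hle q n Hq Dq) as [->|H]; [|exact H].
           exfalso; apply E. now apply mod_eq_0_prime_divides.
        -- rewrite N1; [ring|]. intros (q & Hq & Dq). apply H. exists q. split; [lia|exact Dq].
    + destruct (IH n Hn) as [N0 N1]. split; intros H.
      * apply N0. destruct H as (q & Hq & Dq).
        destruct (Hle q n Hq Dq) as [->|H]; [|exact H].
        exfalso; apply P, Dq.
      * apply N1. intros (q & Hq & Dq). apply H. exists q. split; [lia|exact Dq].
Qed.

Definition unit1 (n : nat) : R := if (n =? 1)%nat then 1 else 0.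

(** Sieving the Dirichlet series [1] creates terms only at integers whose prime
    factors are at most [r].  So when [r + 1] is a prime dividing [n], the coefficient
    at [n] was still zero, and the coefficients never leave [-1, 1]. *)
Lemma sieve_unit1 (r n : nat) : (1 <= n)%nat ->
  Rabs (sieve unit1 r n) <= 1 /\
  (sieve unit1 r n <> 0 -> forall q, prime_divides q n -> (q <= r)%nat).
Proof.
  revert n. induction r as [|r IH]; intros n Hn.
  - simpl. unfold unit1. destruct (Nat.eqb_spec n 1) as [->|E].
    + rewrite Rabs_R1. split; [lra|]. intros _ q D.
      assert (L := prime_divides_le q 1 ltac:(lia) D). destruct D as [P _].
      apply prime_ge_2 in P. lia.
    + rewrite Rabs_R0. split; [lra|]. intros H; now elim H.
  - destruct (IH n Hn) as [B S0].
    cbn [sieve]. destruct (prime_dec _) as [P|P].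
    2: { split; [exact B|]. intros H q D. specialize (S0 H q D). lia. }
    unfold strike. destruct (Nat.eqb_spec (n mod S r) 0) as [E|E].
    2: { rewrite Rminus_0_r. split; [exact B|].
         intros H q D. specialize (S0 H q D). lia. }
    set (m := (n / S r)%nat).
    assert (En : n = (S r * m)%nat).
    { generalize (Nat.div_mod_eq n (S r)). unfold m. lia. }
    assert (Hm : (1 <= m)%nat) by nia.
    destruct (IH m Hm) as [Bm Sm].
    (* A nonzero value would bound the prime factor S r of n by r. *)
    assert (Z0 : sieve unit1 r n = 0).
    { apply NNPP. intros H. assert (D : prime_divides (S r) n) by now apply mod_eq_0_prime_divides.
      specialize (S0 H _ D). lia. }
    rewrite Z0. replace (0 - sieve unit1 r m) with (- sieve unit1 r m) by ring.
    rewrite Rabs_Ropp. split; [exact Bm|]. intros H q D.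
    rewrite En in D. apply prime_divides_mul in D as [->|D]; [lia| |exact P].
    assert (H' : sieve unit1 r m <> 0) by lra.
    specialize (Sm H' q D). lia.
Qed.

(** From step [r = n] on, the sieve no longer changes the coefficient at [n]; this
    value is the Moebius function. *)
Definition mobius (n : nat) : R := sieve unit1 n n.

Lemma mobius_bound (n : nat) : (1 <= n)%nat -> Rabs (mobius n) <= 1.
Proof. intros Hn. apply (sieve_unit1 n n Hn). Qed.

Lemma sieve_unit1_stable (r n : nat) :
  (1 <= n <= r)%nat -> sieve unit1 r n = mobius n.
Proof.
  intros [Hn Hr]. induction Hr as [|r Hr IH]; [reflexivity|].
  cbn [sieve]. destruct (prime_dec _) as [P|P]; [|exact IH].
  unfold strike. rewrite Nat.mod_small by lia.
  destruct (Nat.eqb_spec n 0); [lia|]. rewrite IH. ring.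
Qed.

Lemma psum_unit1 (s n : nat) : (1 <= n)%nat -> psum (dterm unit1 s) n = 1.
Proof.
  intros Hn. induction Hn as [|n Hn IH].
  - unfold psum, dterm, unit1. rewrite pow1. simpl. field.
  - simpl psum. rewrite IH. unfold dterm, unit1.
    destruct (Nat.eqb_spec (S n) 1); [lia | unfold Rdiv; ring].
Qed.

(** After striking the primes up to [r], the sieved series [1] agrees with that of
    [mobius] on the first [r] terms, and the sieved [zeta] agrees with the series [1]
    there.  All tails are [O(1 / r)]. *)
Lemma dseries_mobius (s : nat) : (2 <= s)%nat ->
  dseries mobius s * dseries (fun _ => 1) s = 1.
Proof.
  intros Hs. set (Zs := dseries (fun _ => 1) s).
  assert (B1 : forall n, (1 <= n)%nat -> Rabs ((fun _ : nat => 1) n) <= 1).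
  { intros n _. rewrite Rabs_R1. lra. }
  assert (Bu : forall n, (1 <= n)%nat -> Rabs (unit1 n) <= 1).
  { intros n Hn. apply (sieve_unit1 0 n Hn). }
  assert (U1 : dseries unit1 s = 1).
  { apply Rle_antisym; apply (le_of_forall_div _ _ 1); intros n Hn;
    destruct (dseries_tail unit1 1 s Hs Bu) as [_ T]; specialize (T n Hn);
    rewrite psum_unit1 in T by exact Hn; apply Rabs_le_between in T; lra. }
  assert (K : forall r, (1 <= r)%nat ->
     Rabs (dseries mobius s * Zs - 1) <= 0 + (2 * Rabs Zs + 1) / INR r).
  { intros r Hr.
    assert (Hr0 : 0 < INR r) by (apply lt_0_INR; lia).
    assert (Bm : forall n, (1 <= n)%nat -> Rabs (sieve unit1 r n) <= 1)
      by (intros n Hn; apply (sieve_unit1 r n Hn)).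
    assert (Bz : forall n, (1 <= n)%nat -> Rabs (sieve (fun _ => 1) r n) <= 1).
    { intros n Hn. destruct (sieve_one r n Hn) as [C0 C1].
      destruct (classic (exists q, (q <= r)%nat /\ prime_divides q n)) as [C|C].
      - rewrite (C0 C), Rabs_R0. lra.
      - rewrite (C1 C), Rabs_R1. lra. }
    assert (X := dseries_sieve_cross unit1 (fun _ => 1) 1 1 s r Hs Bu B1).
    rewrite U1, Rmult_1_r in X. fold Zs in X.
    destruct (dseries_tail _ 1 s Hs Bm) as [_ T1]. specialize (T1 r Hr).
    destruct (dseries_tail _ 1 s Hs mobius_bound) as [_ T2]. specialize (T2 r Hr).
    destruct (dseries_tail _ 1 s Hs Bz) as [_ T3]. specialize (T3 r Hr).
    rewrite (psum_ext _ (dterm mobius s)) in T1.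
    2: { intros i Hi. unfold dterm. rewrite sieve_unit1_stable by lia. reflexivity. }
    rewrite (psum_ext _ (dterm unit1 s)) in T3.
    2: { intros i Hi. unfold dterm. f_equal. unfold unit1.
         destruct (Nat.eqb_spec (S i) 1) as [E|E].
         - apply sieve_one; [lia|]. intros (q & Hq & D).
           assert (L := prime_divides_le q (S i) ltac:(lia) D). destruct D as [P _].
           apply prime_ge_2 in P. lia.
         - apply sieve_one; [lia|]. destruct (exists_prime_divides (S i)) as [q D]; [lia|].
           exists q. split; [|exact D].
           assert (L := prime_divides_le q (S i) ltac:(lia) D). lia. }
    rewrite psum_unit1, <- X in T3 by exact Hr.
    assert (T12 : Rabs (dseries mobius s - dseries (sieve unit1 r) s) <= 2 * (1 / INR r)).
    { apply Rabs_le_between in T1. apply Rabs_le_between in T2.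
      apply Rabs_le. lra. }
    replace (dseries mobius s * Zs - 1) with
      ((dseries mobius s - dseries (sieve unit1 r) s) * Zs
       + (dseries (sieve unit1 r) s * Zs - 1)) by ring.
    eapply Rle_trans; [apply Rabs_triang|]. rewrite Rabs_mult.
    replace (0 + (2 * Rabs Zs + 1) / INR r)
      with (2 * (1 / INR r) * Rabs Zs + 1 / INR r) by (field; lra).
    apply Rplus_le_compat; [|exact T3].
    apply Rmult_le_compat_r; [apply Rabs_pos|exact T12]. }
  apply le_of_forall_div in K.
  assert (H := Rabs_pos (dseries mobius s * Zs - 1)).
  assert (H0 : Rabs (dseries mobius s * Zs - 1) = 0) by lra.
  apply Rabs_eq_0 in H0. lra.
Qed.

Lemma inv_zeta (j : nat) :
  / zeta (INR (2 * j + 2)) = dseries mobius (2 * j + 2).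
Proof.
  assert (E : zeta (INR (2 * j + 2)) = dseries (fun _ => 1) (2 * j + 2)).
  { unfold zeta, dseries. apply Series_ext. intros n. unfold dterm.
    rewrite Rpower_pow by (apply lt_0_INR; lia).
    rewrite Nat.add_1_r. unfold Rdiv. ring. }
  assert (H := dseries_mobius (2 * j + 2) ltac:(lia)). rewrite E.
  apply (Rmult_eq_reg_r (dseries (fun _ => 1) (2 * j + 2))).
  - rewrite H. apply Rinv_l. intros Z. rewrite Z in H. lra.
  - intros Z. rewrite Z in H. lra.
Qed.

Lemma inv_zeta_truncate (j N : nat) : (1 <= N)%nat ->
  Rabs (/ zeta (INR (2 * j + 2)) - psum (dterm mobius (2 * j + 2)) N) <= 1 / INR N.
Proof.
  intros HN. rewrite inv_zeta.
  apply (dseries_tail mobius 1 (2 * j + 2)); [lia | exact mobius_bound | exact HN].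
Qed.

(** * Truncated expansions of the two quantities *)

Lemma psum_sum_f_R0 (F : nat -> nat -> R) (k N : nat) :
  sum_f_R0 (fun j => psum (F j) N) k = psum (fun n => sum_f_R0 (fun j => F j n) k) N.
Proof.
  induction k as [|k IH]; simpl.
  - apply psum_ext. reflexivity.
  - rewrite IH. clear. induction N as [|N IH]; simpl; [ring|]. rewrite <- IH. ring.
Qed.

Lemma is_series_psum (F : nat -> nat -> R) (L : nat -> R) (N : nat) :
  (forall n, (n < N)%nat -> is_series (fun k => F k n) (L n)) ->
  is_series (fun k => psum (F k) N) (psum L N).
Proof.
  induction N as [|N IH]; intros H; simpl.
  - change (is_lim_seq (sum_n (fun _ : nat => 0)) 0).
    apply is_lim_seq_ext with (fun _ : nat => 0); [|apply is_lim_seq_const].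
    intros n. induction n as [|n IHn]; [now rewrite sum_O|].
    rewrite sum_Sn, <- IHn. unfold plus; simpl. ring.
  - apply (is_series_plus (fun k => psum (F k) N) (fun k => F k N));
      [apply IH; intros; apply H|apply H]; lia.
Qed.

Lemma Series_approx (f g h : nat -> R) (l e : R) :
  is_series g l -> is_series h e -> (forall k, Rabs (f k - g k) <= h k) ->
  Rabs (Series f - l) <= e.
Proof.
  intros Hg Hh Hd.
  assert (Ea : ex_series (fun k => Rabs (f k - g k))).
  { apply (ex_series_le (K := R_AbsRing) (V := R_CompleteNormedModule) _ h).
    - intros n. change (Rabs (Rabs (f n - g n)) <= h n). rewrite Rabs_Rabsolu. apply Hd.
    - now exists e. }
  assert (Ed : ex_series (fun k => f k - g k)) by now apply ex_series_Rabs.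
  assert (Ef : Series f = Series (fun k => f k - g k) + l).
  { rewrite <- (is_series_unique _ _ Hg).
    rewrite <- Series_plus; [|exact Ed|now exists l].
    apply Series_ext. intros; ring. }
  rewrite Ef. replace (Series (fun k => f k - g k) + l - l)
    with (Series (fun k => f k - g k)) by ring.
  eapply Rle_trans; [apply Series_Rabs, Ea|].
  rewrite <- (is_series_unique _ _ Hh). apply Series_le; [|now exists e].
  intros n. split; [apply Rabs_pos|apply Hd].
Qed.

Lemma is_series_exp (x : R) : is_series (fun k => x ^ k / INR (fact k)) (exp x).
Proof.
  apply is_series_ext with (fun k => / INR (fact k) * x ^ k).
  - intros n. unfold Rdiv. apply Rmult_comm.
  - apply is_pseries_R. apply is_exp_Reals.
Qed.

(** For the truncated Moebius series the sum over [j] is the binomial formula; the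
    errors [1 / N] are weighted by binomial coefficients, which add up to [2^k]. *)
Lemma c_truncate (k N : nat) : (1 <= N)%nat ->
  Rabs (c k - psum (fun n => mobius (S n) / INR (S n) ^ 2 * (1 - / INR (S n) ^ 2) ^ k) N)
  <= 2 ^ k / INR N.
Proof.
  intros HN.
  assert (E : psum (fun n => mobius (S n) / INR (S n) ^ 2 * (1 - / INR (S n) ^ 2) ^ k) N
    = sum_f_R0 (fun j => (-1) ^ j * Binomial.C k j * psum (dterm mobius (2 * j + 2)) N) k).
  { transitivity (sum_f_R0 (fun j =>
      psum (fun n => (-1) ^ j * Binomial.C k j * dterm mobius (2 * j + 2) n) N) k).
    2: { apply sum_eq. intros j _. apply psum_scal. }
    rewrite psum_sum_f_R0. apply psum_ext. intros n _.
    replace (1 - / INR (S n) ^ 2) with (- / INR (S n) ^ 2 + 1) by ring.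
    rewrite binomial, scal_sum. apply sum_eq. intros j _.
    unfold dterm. rewrite pow1, pow_add, pow_mult.
    replace (- / INR (S n) ^ 2) with ((-1) * / INR (S n) ^ 2) by ring.
    rewrite Rpow_mult_distr, pow_inv.
    assert (INR (S n) <> 0) by (apply not_0_INR; lia).
    field. split; [|apply pow_nonzero, pow_nonzero]; assumption. }
  rewrite E. unfold c. rewrite <- minus_sum.
  assert (E2 : 2 ^ k / INR N = sum_f_R0 (fun j => Binomial.C k j * (1 / INR N)) k).
  { replace 2 with (1 + 1) by ring. rewrite binomial. unfold Rdiv at 1.
    rewrite Rmult_comm, scal_sum. apply sum_eq. intros j _.
    rewrite !pow1. unfold Rdiv. ring. }
  rewrite E2.
  eapply Rle_trans; [apply Rsum_abs|]. apply sum_Rle. intros j Hj.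
  replace ((-1) ^ j * Binomial.C k j * (1 / zeta (INR (2 * j + 2))) -
     (-1) ^ j * Binomial.C k j * psum (dterm mobius (2 * j + 2)) N)
    with ((-1) ^ j * (Binomial.C k j *
       (/ zeta (INR (2 * j + 2)) - psum (dterm mobius (2 * j + 2)) N)))
    by (unfold Rdiv; ring).
  rewrite !Rabs_mult, pow_1_abs, Rmult_1_l.
  assert (HC : 0 <= Binomial.C k j).
  { unfold Binomial.C. apply Rlt_le, Rdiv_lt_0_compat.
    - apply INR_fact_lt_0.
    - apply Rmult_lt_0_compat; apply INR_fact_lt_0. }
  rewrite (Rabs_right (Binomial.C k j)) by lra.
  apply Rmult_le_compat_l; [exact HC|]. apply inv_zeta_truncate, HN.
Qed.

(** For the truncated Moebius series the sum over [k] is the exponential series of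
    [- x / n^2]; the errors [1 / N] are weighted by [x^k / k!]. *)
Lemma Riesz_truncate (x : R) (N : nat) : 0 < x -> (1 <= N)%nat ->
  Rabs (Riesz x / x - psum (fun n => mobius (S n) / INR (S n) ^ 2
                                     * exp (- (x * / INR (S n) ^ 2))) N)
  <= exp x / INR N.
Proof.
  intros Hx HN.
  unfold Riesz, PSeries.
  match goal with |- context [x * Series ?f / x] => set (F := f) end.
  replace (x * Series F / x) with (Series F) by (field; lra).
  apply Series_approx with
    (g := fun k => psum (fun n => (-1) ^ k * x ^ k / INR (fact k) * dterm mobius (2 * k + 2) n) N)
    (h := fun k => x ^ k / INR (fact k) * / INR N).
  - apply is_series_psum. intros n _.
    apply is_series_ext with (fun k => mobius (S n) / INR (S n) ^ 2 *
           ((- (x * / INR (S n) ^ 2)) ^ k / INR (fact k))).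
    2: { exact (is_series_scal (mobius (S n) / INR (S n) ^ 2) _ _
                (is_series_exp (- (x * / INR (S n) ^ 2)))). }
    intros k. unfold dterm. rewrite pow_add, pow_mult.
    replace (- (x * / INR (S n) ^ 2)) with ((-1) * (x * / INR (S n) ^ 2)) by ring.
    rewrite !Rpow_mult_distr, pow_inv.
    assert (INR (S n) <> 0) by (apply not_0_INR; lia).
    assert (INR (fact k) <> 0) by apply INR_fact_neq_0.
    match goal with |- ?a = ?b => change (@eq R a b) end.
    field. repeat split; try assumption. apply pow_nonzero, pow_nonzero; assumption.
  - exact (is_series_scal_r (/ INR N) _ _ (is_series_exp x)).
  - intros k. rewrite psum_scal. unfold F.
    assert (HF : 0 < INR (fact k)) by apply INR_fact_lt_0.
    replace ((-1) ^ k / (INR (fact k) * zeta (INR (2 * k + 2))) * x ^ k)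
      with ((-1) ^ k * x ^ k / INR (fact k) * / zeta (INR (2 * k + 2)))
      by (unfold Rdiv; rewrite Rinv_mult; ring).
    rewrite <- Rmult_minus_distr_l, Rabs_mult.
    unfold Rdiv. rewrite !Rabs_mult, pow_1_abs, Rmult_1_l.
    assert (0 < x ^ k) by (apply pow_lt; exact Hx).
    assert (0 < / INR (fact k)) by (apply Rinv_0_lt_compat; exact HF).
    rewrite (Rabs_right (x ^ k)), (Rabs_right (/ INR (fact k))) by lra.
    apply Rmult_le_compat_l; [nra|].
    replace (/ INR N) with (1 / INR N) by (unfold Rdiv; ring).
    apply inv_zeta_truncate, HN.
Qed.

(** * Comparing an exponential with a power *)

Definition gap (k : nat) (x : R) : R := exp (- (INR k * x)) - (1 - x) ^ k.

Lemma exp_pow (x : R) (n : nat) : exp x ^ n = exp (INR n * x).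
Proof.
  induction n as [|n IH].
  - simpl. now rewrite Rmult_0_l, exp_0.
  - rewrite S_INR. simpl pow. rewrite IH, <- exp_plus. f_equal. ring.
Qed.

(** Taking out the exponential leaves [1 - t^k] with [t = (1 - x) exp x <= 1], to
    which Bernoulli's inequality applies. *)
Lemma gap_factor (k : nat) (x : R) :
  gap k x = exp (- (INR k * x)) * (1 - ((1 - x) * exp x) ^ k).
Proof.
  unfold gap. rewrite Rpow_mult_distr, exp_pow.
  replace (exp (- (INR k * x)) * (1 - (1 - x) ^ k * exp (INR k * x)))
    with (exp (- (INR k * x)) - (1 - x) ^ k * (exp (- (INR k * x)) * exp (INR k * x))) by ring.
  rewrite <- exp_plus. replace (- (INR k * x) + INR k * x) with 0 by ring.
  rewrite exp_0. ring.
Qed.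

(** The lower bound is exact for the Taylor polynomial:
    [(1 - x) (1 + x + x^2 / 2) = 1 - (x^2 + x^3) / 2]. *)
Lemma one_minus_mul_exp (x : R) : 0 <= x <= 1 ->
  1 - (x ^ 2 + x ^ 3) / 2 <= (1 - x) * exp x <= 1.
Proof.
  intros Hx. split.
  - assert (H := exp_ge_taylor x 2 (proj1 Hx)). simpl in H.
    assert (E : 1 + x + x ^ 2 / 2 <= exp x) by (simpl; lra).
    replace (1 - (x ^ 2 + x ^ 3) / 2) with ((1 - x) * (1 + x + x ^ 2 / 2)) by field.
    apply Rmult_le_compat_l; lra.
  - assert (H := exp_ineq1_le (- x)).
    apply Rle_trans with (exp (- x) * exp x).
    + apply Rmult_le_compat_r; [apply Rlt_le, exp_pos|lra].
    + rewrite <- exp_plus, Rplus_opp_l, exp_0. lra.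
Qed.

(** Bernoulli's inequality, in the variable [t = 1 + y]. *)
Lemma bernoulli (t : R) (k : nat) : 0 <= t -> 1 - INR k * (1 - t) <= t ^ k.
Proof.
  intros Ht. induction k as [|k IH].
  - simpl. lra.
  - rewrite S_INR. simpl pow.
    assert (t * (1 - INR k * (1 - t)) <= t * t ^ k) by (apply Rmult_le_compat_l; lra).
    assert (0 <= INR k) by apply pos_INR.
    assert (0 <= INR k * ((1 - t) * (1 - t))) by 
      (apply Rmult_le_pos; [assumption|exact (Rle_0_sqr (1 - t))]).
    nra.
Qed.

Lemma gap_nonneg (k : nat) (x : R) : 0 <= x <= 1 -> 0 <= gap k x.
Proof.
  intros Hx. rewrite gap_factor. destruct (one_minus_mul_exp x Hx) as [_ H].
  apply Rmult_le_pos; [apply Rlt_le, exp_pos|].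
  assert (((1 - x) * exp x) ^ k <= 1 ^ k).
  { apply pow_incr. split; [|exact H].
    apply Rmult_le_pos; [lra|apply Rlt_le, exp_pos]. }
  rewrite pow1 in H0. lra.
Qed.

Lemma gap_le (k : nat) (x : R) : 0 <= x <= 1 ->
  gap k x <= INR k * ((x ^ 2 + x ^ 3) / 2) * exp (- (INR k * x)).
Proof.
  intros Hx. rewrite gap_factor. destruct (one_minus_mul_exp x Hx) as [H _].
  rewrite Rmult_comm. apply Rmult_le_compat_r; [apply Rlt_le, exp_pos|].
  assert (B : 0 <= (1 - x) * exp x)
    by (apply Rmult_le_pos; [lra|apply Rlt_le, exp_pos]).
  apply (bernoulli _ k) in B.
  assert (INR k * (1 - (1 - x) * exp x) <= INR k * ((x ^ 2 + x ^ 3) / 2))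
    by (apply Rmult_le_compat_l; [apply pos_INR|lra]).
  lra.
Qed.

(** The [m]-th power of [v / m <= exp (v / m - 1)]; the maximum is at [v = m]. *)
Lemma pow_mul_exp_neg_le (v : R) (m : nat) : (1 <= m)%nat -> 0 <= v ->
  v ^ m * exp (- v) <= INR m ^ m * exp (- INR m).
Proof.
  intros Hm Hv.
  assert (HM : 0 < INR m) by (apply lt_0_INR; lia).
  assert (H : v / INR m <= exp (v / INR m - 1)).
  { generalize (exp_ineq1_le (v / INR m - 1)). lra. }
  assert (H1 : (v / INR m) ^ m <= exp (v / INR m - 1) ^ m).
  { apply pow_incr. split; [|exact H]. apply Rdiv_le_0_compat; assumption. }
  rewrite exp_pow in H1.
  replace (INR m * (v / INR m - 1)) with (v + - INR m) in H1 by (field; lra).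
  assert (E : v ^ m * exp (- v) = INR m ^ m * ((v / INR m) ^ m * exp (- v))).
  { rewrite <- Rmult_assoc, <- Rpow_mult_distr. f_equal. f_equal. field. lra. }
  rewrite E. apply Rmult_le_compat_l; [apply pow_le; lra|].
  apply Rle_trans with (exp (v + - INR m) * exp (- v)).
  - apply Rmult_le_compat_r; [apply Rlt_le, exp_pos|exact H1].
  - rewrite <- exp_plus. apply Req_le. f_equal. ring.
Qed.

(** The function [H] of the introduction; its value at [1 / n^2] bounds the [n]-th
    term of the difference. *)
Definition weighted (k : nat) (x : R) : R := x * gap k x.

Definition peak (k : nat) : R :=
  27 / 2 * exp (-3) / INR k ^ 2 + 128 * exp (-4) / INR k ^ 3.

Lemma weighted_le_peak (k : nat) (x : R) : (1 <= k)%nat -> 0 <= x <= 1 ->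
  weighted k x <= peak k.
Proof.
  intros Hk Hx. assert (HK : 0 < INR k) by (apply lt_0_INR; lia).
  unfold weighted, peak.
  apply Rle_trans with (x * (INR k * ((x ^ 2 + x ^ 3) / 2) * exp (- (INR k * x)))).
  { apply Rmult_le_compat_l; [lra|apply gap_le, Hx]. }
  assert (Hv : 0 <= INR k * x) by (apply Rmult_le_pos; lra).
  assert (H3 := pow_mul_exp_neg_le (INR k * x) 3 ltac:(lia) Hv).
  assert (H4 := pow_mul_exp_neg_le (INR k * x) 4 ltac:(lia) Hv).
  set (e := exp (- (INR k * x))) in *.
  replace (INR 3) with 3 in H3 by (simpl; ring).
  replace (INR 4) with 4 in H4 by (simpl; ring).
  replace (x * (INR k * ((x ^ 2 + x ^ 3) / 2) * e))
    with ((INR k * x) ^ 3 * e * / (2 * INR k ^ 2) + (INR k * x) ^ 4 * e * / (2 * INR k ^ 3))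
    by (field; lra).
  replace (27 / 2 * exp (-3) / INR k ^ 2) with (3 ^ 3 * exp (-3) * / (2 * INR k ^ 2))
    by (field; lra).
  replace (128 * exp (-4) / INR k ^ 3) with (4 ^ 4 * exp (-4) * / (2 * INR k ^ 3))
    by (field; lra).
  assert (0 < INR k ^ 2) by (apply pow_lt; exact HK).
  assert (0 < INR k ^ 3) by (apply pow_lt; exact HK).
  apply Rplus_le_compat; apply Rmult_le_compat_r; try assumption;
    apply Rlt_le, Rinv_0_lt_compat; lra.
Qed.

Lemma Riesz_c_le_psum (k N : nat) : (1 <= k)%nat -> (1 <= N)%nat ->
  Rabs (Riesz (INR k) / INR k - c k) <=
  psum (fun n => weighted k (/ INR (S n) ^ 2)) N
  + (exp (INR k) + 2 ^ k) / INR N.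
Proof.
  intros Hk HN.
  assert (HK : 0 < INR k) by (apply lt_0_INR; lia).
  set (A := psum (fun n => mobius (S n) / INR (S n) ^ 2
                                     * exp (- (INR k * / INR (S n) ^ 2))) N).
  set (B := psum (fun n => mobius (S n) / INR (S n) ^ 2 * (1 - / INR (S n) ^ 2) ^ k) N).
  assert (HA : Rabs (Riesz (INR k) / INR k - A) <= exp (INR k) / INR N)
    by (apply Riesz_truncate; assumption).
  assert (HB : Rabs (c k - B) <= 2 ^ k / INR N) by (apply c_truncate; assumption).
  assert (EAB : A - B = psum (fun n => mobius (S n) * weighted k (/ INR (S n) ^ 2)) N).
  { unfold A, B, weighted, gap. clear. induction N as [|N IH]; cbn [psum]; [ring|].
    rewrite <- IH. unfold Rdiv. ring. }
  assert (HAB : Rabs (A - B) <= psum (fun n => weighted k (/ INR (S n) ^ 2)) N).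
  { rewrite EAB. apply psum_Rabs_le. intros n _. unfold weighted.
    assert (H1 : 1 <= INR (S n)) by (rewrite S_INR; generalize (pos_INR n); lra).
    assert (H2 : 0 < / INR (S n) ^ 2) by (apply Rinv_0_lt_compat; nra).
    assert (H3 : / INR (S n) ^ 2 <= 1) by (rewrite <- Rinv_1; apply Rinv_le_contravar; nra).
    assert (H4 : 0 <= gap k (/ INR (S n) ^ 2)) by (apply gap_nonneg; lra).
    rewrite Rabs_mult.
    rewrite (Rabs_right (/ INR (S n) ^ 2 * gap k (/ INR (S n) ^ 2))) by nra.
    rewrite <- (Rmult_1_l (/ INR (S n) ^ 2 * gap k (/ INR (S n) ^ 2))) at 2.
    apply Rmult_le_compat_r; [nra|]. apply mobius_bound. lia. }
  replace (Riesz (INR k) / INR k - c k) with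
    ((A - B) + ((Riesz (INR k) / INR k - A) - (c k - B))) by ring.
  eapply Rle_trans; [apply Rabs_triang|]. apply Rplus_le_compat; [exact HAB|].
  unfold Rminus at 1. eapply Rle_trans; [apply Rabs_triang|]. rewrite Rabs_Ropp.
  unfold Rdiv. rewrite Rmult_plus_distr_r. apply Rplus_le_compat; assumption.
Qed.

(** * The weighted gap rises and then falls *)

(** Stated for the exponent [m + 1], so that the derivative involves the power [m]
    and no predecessor. *)
Definition dweighted (m : nat) (x : R) : R :=
  exp (- (INR (S m) * x)) * (1 - INR (S m) * x)
  - (1 - x) ^ m * (1 - (INR (S m) + 1) * x).

Lemma is_derive_weighted (m : nat) (x : R) :
  is_derive (weighted (S m)) x (dweighted m x).
Proof.
  unfold weighted, gap. auto_derive; [exact I|].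
  unfold dweighted. simpl pred.
  replace ((1 - x) ^ S m) with ((1 - x) * (1 - x) ^ m) by reflexivity.
  change (match m with 0%nat => 1 | S _ => INR m + 1 end) with (INR (S m)).
  unfold Rminus. ring.
Qed.

(** Rests on [(1 - x)^k <= exp (- k x)] and [1 - (k + 1) x <= (1 - x) (1 - k x)],
    with [k = m + 1]. *)
Lemma dweighted_nonneg (m : nat) (x : R) :
  0 < x <= 1 -> INR (S m) * x <= 1 -> 0 <= dweighted m x.
Proof.
  intros Hx Hk. unfold dweighted.
  assert (Hg := gap_nonneg (S m) x ltac:(lra)). unfold gap in Hg.
  set (e := exp (- (INR (S m) * x))) in *. set (K := INR (S m)) in *.
  assert (HK : 1 <= K) by (unfold K; rewrite S_INR; generalize (pos_INR m); lra).
  assert (He : 0 < e) by apply exp_pos.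
  assert (Hp : 0 <= (1 - x) ^ m) by (apply pow_le; lra).
  replace ((1 - x) ^ S m) with ((1 - x) * (1 - x) ^ m) in Hg by reflexivity.
  set (p := (1 - x) ^ m) in *.
  destruct (Rle_dec 1 ((K + 1) * x)) as [C|C].
  - assert (0 <= e * (1 - K * x)) by (apply Rmult_le_pos; lra).
    assert (0 <= p * ((K + 1) * x - 1)) by (apply Rmult_le_pos; lra).
    lra.
  - assert (Hx1 : x < 1) by nra.
    assert (A : (1 - x) * p * (1 - K * x) <= e * (1 - K * x))
      by (apply Rmult_le_compat_r; lra).
    assert (B : 1 - (K + 1) * x <= (1 - x) * (1 - K * x)) by nra.
    assert (p * (1 - (K + 1) * x) <= p * ((1 - x) * (1 - K * x)))
      by (apply Rmult_le_compat_l; assumption).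
    lra.
Qed.

(** [(1 - x)^m exp ((m + 1) x)] decreases beyond [x = 1 / (m + 1)], because
    [(1 - y) / (1 - x) <= exp (- (y - x) / (1 - x))] and
    [m / (1 - x) >= m + 1] there. *)
Lemma pow_mul_exp_decr (m : nat) (x y : R) :
  1 <= INR (S m) * x -> x <= y -> y < 1 ->
  (1 - y) ^ m * exp (INR (S m) * y) <= (1 - x) ^ m * exp (INR (S m) * x).
Proof.
  intros Hx Hxy Hy. rewrite S_INR in *.
  assert (Hm := pos_INR m).
  set (t := (y - x) / (1 - x)).
  assert (H1 : 1 - y <= (1 - x) * exp (- t)).
  { generalize (exp_ineq1_le (- t)); intros H.
    replace (1 - y) with ((1 - x) * (1 + - t)) by (unfold t; field; lra).
    apply Rmult_le_compat_l; lra. }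
  assert (H2 : (1 - y) ^ m <= ((1 - x) * exp (- t)) ^ m) by (apply pow_incr; lra).
  rewrite Rpow_mult_distr, exp_pow in H2.
  apply Rle_trans with ((1 - x) ^ m * exp (INR m * - t) * exp ((INR m + 1) * y)).
  { apply Rmult_le_compat_r; [apply Rlt_le, exp_pos|exact H2]. }
  rewrite Rmult_assoc, <- exp_plus.
  apply Rmult_le_compat_l; [apply pow_le; lra|].
  apply Rnot_lt_le; intros L; apply exp_lt_inv in L.
  assert (Ht : INR m * t >= (INR m + 1) * (y - x)).
  { unfold t. apply Rle_ge. apply (Rmult_le_reg_r (1 - x)); [lra|].
    replace (INR m * ((y - x) / (1 - x)) * (1 - x)) with (INR m * (y - x)) by (field; lra).
    assert (0 <= (y - x) * ((INR m + 1) * x - 1)) by (apply Rmult_le_pos; lra).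
    nra. }
  lra.
Qed.

(** With [K = m + 1], a negative derivative forces [K x > 1].  There its sign is that
    of [Q - 1] with [Q = (1 - x)^m exp (K x) ((K + 1) x - 1) / (K x - 1)], a product of
    two decreasing positive functions. *)
Lemma dweighted_sign (m : nat) (x y : R) :
  0 < x -> x < y -> y < 1 -> dweighted m x < 0 -> dweighted m y <= 0.
Proof.
  intros Hx Hxy Hy Hneg.
  set (K := INR (S m)).
  assert (HK : 1 <= K) by (unfold K; rewrite S_INR; generalize (pos_INR m); lra).
  assert (C : 1 < K * x).
  { apply Rnot_le_lt. intros C. generalize (dweighted_nonneg m x ltac:(lra) C). lra. }
  assert (F : forall z, dweighted m z = exp (- (K * z)) *
     ((1 - z) ^ m * exp (K * z) * ((K + 1) * z - 1) - (K * z - 1))).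
  { intros z. unfold dweighted. fold K.
    replace (exp (- (K * z)) *
     ((1 - z) ^ m * exp (K * z) * ((K + 1) * z - 1) - (K * z - 1)))
     with ((1 - z) ^ m * (exp (- (K * z)) * exp (K * z)) * ((K + 1) * z - 1)
           - exp (- (K * z)) * (K * z - 1)) by ring.
    rewrite <- exp_plus, Rplus_opp_l, exp_0. ring. }
  assert (Q := pow_mul_exp_decr m x y ltac:(fold K; lra) ltac:(lra) Hy). fold K in Q.
  rewrite F in Hneg |- *.
  set (qx := (1 - x) ^ m * exp (K * x)) in *.
  set (qy := (1 - y) ^ m * exp (K * y)) in *.
  assert (E1 : 0 < exp (- (K * x))) by apply exp_pos.
  assert (E2 : 0 < exp (- (K * y))) by apply exp_pos.
  assert (Hqx : qx * ((K + 1) * x - 1) < K * x - 1) by nra.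
  assert (Hqy0 : 0 <= qy).
  { unfold qy. apply Rmult_le_pos; [apply pow_le; lra|apply Rlt_le, exp_pos]. }
  (* Cross-multiplied form of: ((K + 1) z - 1) / (K z - 1) decreases in z. *)
  assert (Hcross : ((K + 1) * y - 1) * (K * x - 1) <= ((K + 1) * x - 1) * (K * y - 1)) by nra.
  assert (Hqy : qy * ((K + 1) * y - 1) <= K * y - 1).
  { assert (P1 : 0 < K * x - 1) by lra. assert (P2 : 0 < K * y - 1) by nra.
    apply (Rmult_le_reg_r (K * x - 1)); [exact P1|].
    apply Rle_trans with (qy * (((K + 1) * x - 1) * (K * y - 1))).
    { rewrite Rmult_assoc. apply Rmult_le_compat_l; assumption. }
    apply Rle_trans with (qx * (((K + 1) * x - 1) * (K * y - 1))).
    { apply Rmult_le_compat_r; [|exact Q]. apply Rmult_le_pos; lra. }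
    rewrite <- Rmult_assoc, (Rmult_comm (K * y - 1)).
    apply Rmult_le_compat_r; lra. }
  assert (exp (- (K * y)) * (qy * ((K + 1) * y - 1) - (K * y - 1)) <= exp (- (K * y)) * 0)
    by (apply Rmult_le_compat_l; lra).
  lra.
Qed.

Lemma is_derive_MVT (f df : R -> R) (a b : R) :
  (forall x, is_derive f x (df x)) -> a < b ->
  exists z, a < z < b /\ f b - f a = df z * (b - a).
Proof.
  intros Hf Hab.
  destruct (MVT_cor2 f df a b Hab) as [z [E Hz]].
  - intros x _. apply is_derive_Reals, Hf.
  - exists z. split; assumption.
Qed.

(** Unimodality without naming the mode: a value below both end values would, by the
    mean value theorem, give a negative derivative followed by a positive one. *)
Lemma weighted_quasiconcave (k : nat) (a b d : R) : (1 <= k)%nat ->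
  0 < a -> a <= b -> b <= d -> d <= 1 ->
  Rmin (weighted k a) (weighted k d) <= weighted k b.
Proof.
  intros Hk Ha Hab Hbd Hd.
  destruct k as [|m]; [lia|].
  apply Rnot_lt_le. intros H.
  assert (H1 : weighted (S m) b < weighted (S m) a)
    by (eapply Rlt_le_trans; [exact H|apply Rmin_l]).
  assert (H2 : weighted (S m) b < weighted (S m) d)
    by (eapply Rlt_le_trans; [exact H|apply Rmin_r]).
  destruct Hab as [Hab| ->]; [|lra]. destruct Hbd as [Hbd| ->]; [|lra].
  destruct (is_derive_MVT _ _ a b (is_derive_weighted m) Hab) as [x [Hx Ex]].
  destruct (is_derive_MVT _ _ b d (is_derive_weighted m) Hbd) as [y [Hy Ey]].
  assert (Nx : dweighted m x < 0) by nra.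
  assert (Ny := dweighted_sign m x y ltac:(lra) ltac:(lra) ltac:(lra) Nx).
  nra.
Qed.

(** * Comparing the sum with an integral *)

(** For a sequence that rises and then falls, every term but the largest is the
    minimum of itself and the next term towards the peak. *)
Lemma psum_quasiconcave (h : nat -> R) :
  (forall a b d, (a <= b <= d)%nat -> Rmin (h a) (h d) <= h b) ->
  forall (N : nat) (M : R), (forall n, (n <= N)%nat -> h n <= M) ->
  psum h (S N) <= M + psum (fun n => Rmin (h n) (h (S n))) N.
Proof.
  intros Hq. induction N as [|N IH]; intros M HM.
  - cbn [psum]. generalize (HM O ltac:(lia)). lra.
  - change (psum h (S N) + h (S N) <=
      M + (psum (fun n => Rmin (h n) (h (S n))) N + Rmin (h N) (h (S N)))).
    destruct (Rle_dec (h (S N)) (h N)) as [L|L].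
    + rewrite Rmin_right by exact L.
      generalize (IH M ltac:(intros; apply HM; lia)). lra.
    + apply Rnot_le_lt in L. rewrite Rmin_left by lra.
      (* The sequence is still rising at N, so h N bounds all earlier terms. *)
      assert (HN : forall n, (n <= N)%nat -> h n <= h N).
      { intros n Hn. generalize (Hq n N (S N) ltac:(lia)). intros Q.
        unfold Rmin in Q. destruct (Rle_dec (h n) (h (S N))); lra. }
      generalize (IH (h N) HN) (HM (S N) ltac:(lia)). lra.
Qed.

Lemma ex_RInt_of_ex_derive (f : R -> R) (a b : R) :
  (forall x, ex_derive f x) -> ex_RInt f a b.
Proof.
  intros H. apply (ex_RInt_continuous (V := R_CompleteNormedModule)).
  intros x _. apply (ex_derive_continuous f x (H x)).
Qed.

Lemma is_RInt_primitive (F f : R -> R) (a b : R) : a <= b ->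
  (forall x, a <= x <= b -> is_derive F x (f x) /\ ex_derive f x) ->
  is_RInt f a b (F b - F a).
Proof.
  intros Hab H. apply (is_RInt_derive (V := R_CompleteNormedModule) F);
    rewrite Rmin_left, Rmax_right by exact Hab; intros x Hx.
  - apply H, Hx.
  - apply (ex_derive_continuous f). apply H, Hx.
Qed.

Lemma RInt_split (f : R -> R) (a b d : R) :
  ex_RInt f a b -> ex_RInt f b d -> RInt f a d = RInt f a b + RInt f b d.
Proof. intros H1 H2. symmetry. now apply (RInt_Chasles (V := R_CompleteNormedModule)). Qed.

Lemma ex_RInt_exp_sq (K a b : R) : ex_RInt (fun u => exp (- (K * u ^ 2))) a b.
Proof. apply ex_RInt_of_ex_derive. intros x. auto_derive. exact I. Qed.

Lemma ex_RInt_wallis (k : nat) (a b : R) : ex_RInt (fun u => (1 - u ^ 2) ^ k) a b.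
Proof. apply ex_RInt_of_ex_derive. intros x. auto_derive. exact I. Qed.

Lemma ex_RInt_gap_sq (k : nat) (a b : R) : ex_RInt (fun u => gap k (u ^ 2)) a b.
Proof.
  unfold gap.
  apply (ex_RInt_minus (V := R_NormedModule) (fun u => exp (- (INR k * u ^ 2)))
           (fun u => (1 - u ^ 2) ^ k));
    [apply ex_RInt_exp_sq|apply ex_RInt_wallis].
Qed.

Lemma is_RInt_inv_sq (m a b : R) : 0 < a -> a <= b ->
  is_RInt (fun u => m / u ^ 2) a b (m * (/ a - / b)).
Proof.
  intros Ha Hab.
  replace (m * (/ a - / b)) with (- m / b - - m / a) by (field; lra).
  apply (is_RInt_primitive (fun u => - m / u)); [exact Hab|].
  intros x Hx. split.
  - auto_derive; [lra|]. field. lra.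
  - auto_derive. simpl. nra.
Qed.

(** With [u = 1 / n], the gap at [u^2] is [weighted k (u^2) / u^2], and [1 / u^2] has
    integral [1] over each interval [1 / (n + 1) <= u <= 1 / n].  By quasi-concavity the
    integral over it is at least the smaller of the two end values of [weighted]. *)
Lemma psum_weighted_le (k N : nat) : (1 <= k)%nat ->
  psum (fun n => weighted k (/ INR (S n) ^ 2)) (S N)
  <= peak k + RInt (fun u => gap k (u ^ 2)) 0 1.
Proof.
  intros Hk. set (h := fun n => weighted k (/ INR (S n) ^ 2)).
  set (g := fun u => gap k (u ^ 2)).
  assert (Hpos : forall n, 1 <= INR (S n))
    by (intros n; rewrite S_INR; generalize (pos_INR n); lra).
  assert (Hinv : forall n, 0 < / INR (S n) <= 1).
  { intros n. specialize (Hpos n). split; [apply Rinv_0_lt_compat; lra|].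
    rewrite <- Rinv_1. apply Rinv_le_contravar; lra. }
  assert (Hmono : forall a b, (a <= b)%nat -> / INR (S b) <= / INR (S a)).
  { intros a b Hab. apply Rinv_le_contravar; [specialize (Hpos a); lra|].
    apply le_INR. lia. }
  assert (Hg : forall a b, 0 <= a -> a <= b -> b <= 1 -> 0 <= RInt g a b).
  { intros a b Ha Hab Hb. apply RInt_ge_0; [exact Hab|apply ex_RInt_gap_sq|].
    intros u Hu. apply gap_nonneg. nra. }
  assert (Hblock : forall n, Rmin (h n) (h (S n)) <= RInt g (/ INR (S (S n))) (/ INR (S n))).
  { intros n. set (v := Rmin (h n) (h (S n))).
    assert (Hm := Hmono n (S n) ltac:(lia)).
    destruct (Hinv n) as [I1 I2]. destruct (Hinv (S n)) as [I3 I4].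
    assert (E := is_RInt_inv_sq v _ _ I3 Hm).
    rewrite !Rinv_inv in E.
    replace (v * (INR (S (S n)) - INR (S n))) with v in E by (rewrite (S_INR (S n)); ring).
    rewrite <- (is_RInt_unique _ _ _ _ E).
    apply RInt_le; [exact Hm|now exists v|apply ex_RInt_gap_sq|].
    intros u Hu. assert (Hu0 : 0 < u) by lra.
    assert (Q : v <= weighted k (u ^ 2)).
    { unfold v, h. rewrite Rmin_comm. rewrite <- !pow_inv.
      apply weighted_quasiconcave;
        [exact Hk | apply pow_lt; assumption | apply pow_incr; lra
        | apply pow_incr; lra | nra]. }
    unfold weighted in Q. unfold g.
    apply (Rmult_le_reg_r (u ^ 2)); [apply pow_lt; exact Hu0|].
    replace (v / u ^ 2 * u ^ 2) with v by (field; lra). lra. }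
  assert (Hsum : forall n, psum (fun n => Rmin (h n) (h (S n))) n <= RInt g (/ INR (S n)) 1).
  { induction n as [|n IH].
    - cbn [psum]. destruct (Hinv O). apply Hg; lra.
    - cbn [psum]. rewrite (RInt_split g _ (/ INR (S n)) _) by apply ex_RInt_gap_sq.
      generalize (Hblock n). lra. }
  apply Rle_trans with (peak k + psum (fun n => Rmin (h n) (h (S n))) N).
  - apply psum_quasiconcave.
    + intros a b d Hab. unfold h. rewrite Rmin_comm.
      apply weighted_quasiconcave; try exact Hk; rewrite <- ?pow_inv.
      * apply pow_lt, Hinv.
      * apply pow_incr. split; [apply Rlt_le, Hinv|apply Hmono; lia].
      * apply pow_incr. split; [apply Rlt_le, Hinv|apply Hmono; lia].
      * rewrite <- (pow1 2). apply pow_incr. destruct (Hinv a). lra.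
    + intros n _. apply weighted_le_peak; [exact Hk|]. rewrite <- pow_inv.
      destruct (Hinv n). nra.
  - apply Rplus_le_compat_l. eapply Rle_trans; [apply Hsum|].
    destruct (Hinv N) as [I1 I2].
    rewrite (RInt_split g 0 (/ INR (S N)) 1) by apply ex_RInt_gap_sq.
    generalize (Hg 0 (/ INR (S N)) ltac:(lra) ltac:(lra) I2). lra.
Qed.

(** * Wallis integrals *)

Definition cosint (n : nat) : R := RInt (fun x => cos x ^ n) 0 (PI / 2).

Lemma ex_RInt_cos_pow (n : nat) (a b : R) : ex_RInt (fun x => cos x ^ n) a b.
Proof. apply ex_RInt_of_ex_derive. intros x. auto_derive. exact I. Qed.

Lemma cos_in_unit (x : R) : 0 < x < PI / 2 -> 0 <= cos x <= 1.
Proof. intros Hx. split; [apply cos_ge_0; lra|apply COS_bound]. Qed.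

Lemma cosint_nonneg (n : nat) : 0 <= cosint n.
Proof.
  assert (HP := PI_RGT_0).
  apply RInt_ge_0; [lra|apply ex_RInt_cos_pow|].
  intros x Hx. apply pow_le. apply cos_in_unit, Hx.
Qed.

Lemma cosint_decr (n : nat) : cosint (S n) <= cosint n.
Proof.
  assert (HP := PI_RGT_0).
  apply RInt_le; [lra|apply ex_RInt_cos_pow|apply ex_RInt_cos_pow|].
  intros x Hx. destruct (cos_in_unit x Hx) as [C0 C1]. simpl.
  rewrite <- (Rmult_1_l (cos x ^ n)) at 2.
  apply Rmult_le_compat_r; [now apply pow_le|exact C1].
Qed.

Lemma RInt_lin_comb (f g : R -> R) (p q a b : R) :
  ex_RInt f a b -> ex_RInt g a b ->
  RInt (fun x => p * f x - q * g x) a b = p * RInt f a b - q * RInt g a b.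
Proof.
  intros Hf Hg. apply is_RInt_unique.
  apply (is_RInt_minus (V := R_NormedModule) (fun x => p * f x) (fun x => q * g x)).
  - exact (is_RInt_scal (V := R_NormedModule) f a b p
             _ (RInt_correct (V := R_CompleteNormedModule) f a b Hf)).
  - exact (is_RInt_scal (V := R_NormedModule) g a b q
             _ (RInt_correct (V := R_CompleteNormedModule) g a b Hg)).
Qed.

(** Integrates the derivative of [sin x * cos x ^ (n + 1)]. *)
Lemma cosint_rec (n : nat) :
  (INR n + 2) * cosint (S (S n)) = (INR n + 1) * cosint n.
Proof.
  assert (H : is_RInt (fun x => (INR n + 2) * cos x ^ S (S n) - (INR n + 1) * cos x ^ n)
                0 (PI / 2) (sin (PI / 2) * cos (PI / 2) ^ S n - sin 0 * cos 0 ^ S n)).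
  { apply (is_RInt_primitive (fun x => sin x * cos x ^ S n));
      [generalize PI_RGT_0; lra|]. intros x _. split.
    - auto_derive; [exact I|].
      change (match n with 0%nat => 1 | S _ => INR n + 1 end) with (INR (S n)).
      rewrite S_INR. simpl pow. 
      assert (E : sin x * sin x = 1 - cos x * cos x)
        by (generalize (sin2_cos2 x); unfold Rsqr; lra).
      replace (sin x * ((INR n + 1) * (- sin x) * cos x ^ n))
        with (- (INR n + 1) * (sin x * sin x) * cos x ^ n) by ring.
      ring [E].
    - auto_derive. repeat split. }
  apply (is_RInt_unique (V := R_CompleteNormedModule)) in H.
  rewrite RInt_lin_comb in H by apply ex_RInt_cos_pow.
  fold (cosint (S (S n))) (cosint n) in H.
  rewrite cos_PI2, sin_0 in H. simpl in H. lra.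
Qed.

Lemma cosint_0 : cosint 0 = PI / 2.
Proof.
  unfold cosint. simpl. rewrite RInt_const. change ((PI / 2 - 0) * 1 = PI / 2). ring.
Qed.

Lemma cosint_1 : cosint 1 = 1.
Proof.
  unfold cosint. apply is_RInt_unique.
  replace 1 with (sin (PI / 2) - sin 0) by (rewrite sin_PI2, sin_0; ring).
  apply (is_RInt_primitive sin); [generalize PI_RGT_0; lra|].
  intros x _. split.
  - auto_derive; [exact I|]. simpl. ring.
  - auto_derive. exact I.
Qed.

(** By [cosint_rec] the left side does not depend on [n]. *)
Lemma cosint_product (n : nat) : (INR n + 1) * (cosint n * cosint (S n)) = PI / 2.
Proof.
  induction n as [|n IH].
  - rewrite cosint_0, cosint_1. simpl. ring.
  - rewrite S_INR, <- IH. generalize (cosint_rec n). intros E.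
    replace ((INR n + 1 + 1) * (cosint (S n) * cosint (S (S n))))
      with (cosint (S n) * ((INR n + 2) * cosint (S (S n)))) by ring.
    rewrite E. ring.
Qed.

Definition wallis (k : nat) : R := RInt (fun u => (1 - u ^ 2) ^ k) 0 1.

(** Integrates the derivative of [u * (1 - u ^ 2) ^ (k + 1)]. *)
Lemma wallis_rec (k : nat) : (2 * INR k + 3) * wallis (S k) = (2 * INR k + 2) * wallis k.
Proof.
  assert (H : is_RInt (fun u => (2 * INR k + 3) * (1 - u ^ 2) ^ S k
                                - (2 * INR k + 2) * (1 - u ^ 2) ^ k)
                0 1 (1 * (1 - 1 ^ 2) ^ S k - 0 * (1 - 0 ^ 2) ^ S k)).
  { apply (is_RInt_primitive (fun u => u * (1 - u ^ 2) ^ S k)); [lra|].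
    intros x _. split.
    - auto_derive; [exact I|].
      change (match k with 0%nat => 1 | S _ => INR k + 1 end) with (INR (S k)).
      rewrite S_INR. simpl. unfold Rminus. generalize ((1 + - (x * (x * 1))) ^ k). intros p. ring.
    - auto_derive. repeat split. }
  apply (is_RInt_unique (V := R_CompleteNormedModule)) in H.
  rewrite RInt_lin_comb in H by apply ex_RInt_wallis.
  fold (wallis (S k)) (wallis k) in H.
  replace (1 - 1 ^ 2) with 0 in H by ring.
  rewrite pow_i in H by lia. lra.
Qed.

(** Both sides satisfy the same recurrence, which replaces the substitution
    [u = sin x]. *)
Lemma wallis_cosint (k : nat) : wallis k = cosint (2 * k + 1).
Proof.
  induction k as [|k IH].
  - change (2 * 0 + 1)%nat with 1%nat. rewrite cosint_1. unfold wallis.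
    rewrite (RInt_ext _ (fun _ => 1)) by reflexivity.
    rewrite RInt_const. change ((1 - 0) * 1 = 1). ring.
  - assert (H := cosint_rec (2 * k + 1)).
    replace (2 * S k + 1)%nat with (S (S (2 * k + 1))) by lia.
    rewrite <- IH in H. generalize (wallis_rec k). intros W.
    rewrite plus_INR, mult_INR in H. simpl in H.
    assert (0 <= INR k) by apply pos_INR.
    apply (Rmult_eq_reg_l (2 * INR k + 3)); [|lra]. rewrite W.
    replace (2 * INR k + 3) with ((1 + 1) * INR k + 1 + 2) by ring. simpl. rewrite H. ring.
Qed.

Lemma wallis_nonneg (k : nat) : 0 <= wallis k.
Proof. rewrite wallis_cosint. apply cosint_nonneg. Qed.

Lemma wallis_sq_le (k : nat) : (4 * INR k + 2) * wallis k ^ 2 <= PI.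
Proof.
  rewrite wallis_cosint, Nat.add_1_r.
  assert (P := cosint_product (2 * k)). rewrite mult_INR in P. simpl INR in P.
  assert (D := cosint_decr (2 * k)). assert (N := cosint_nonneg (S (2 * k))).
  assert (HK := pos_INR k).
  assert (cosint (S (2 * k)) ^ 2 <= cosint (2 * k) * cosint (S (2 * k)))
    by (simpl; rewrite Rmult_1_r; apply Rmult_le_compat_r; assumption).
  assert ((2 * INR k + 1) * cosint (S (2 * k)) ^ 2
          <= (2 * INR k + 1) * (cosint (2 * k) * cosint (S (2 * k))))
    by (apply Rmult_le_compat_l; lra).
  lra.
Qed.

Lemma wallis_sq_ge (k : nat) : PI <= 4 * (INR k + 1) * wallis k ^ 2.
Proof.
  rewrite wallis_cosint.
  assert (P := cosint_product (2 * k + 1)). rewrite plus_INR, mult_INR in P. simpl INR in P.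
  assert (D := cosint_decr (2 * k + 1)). assert (N := cosint_nonneg (2 * k + 1)).
  assert (HK := pos_INR k).
  assert (cosint (2 * k + 1) * cosint (S (2 * k + 1)) <= cosint (2 * k + 1) ^ 2)
    by (simpl pow; rewrite Rmult_1_r; apply Rmult_le_compat_l; assumption).
  assert ((2 * INR k + 2) * (cosint (2 * k + 1) * cosint (S (2 * k + 1)))
     <= (2 * INR k + 2) * cosint (2 * k + 1) ^ 2)
    by (apply Rmult_le_compat_l; lra).
  lra.
Qed.

(** The square of [wallis k] over that of [k^-1/2 (1 - 3 / (8 k))].  It decreases to
    [PI / 4]. *)
Definition wallis_ratio (k : nat) : R :=
  wallis k ^ 2 * INR k ^ 3 / (INR k - 3 / 8) ^ 2.

Lemma wallis_ratio_decr (k : nat) : (1 <= k)%nat -> wallis_ratio (S k) <= wallis_ratio k.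
Proof.
  intros Hk. unfold wallis_ratio. rewrite S_INR.
  assert (HK : 1 <= INR k) by (apply (le_INR 1); exact Hk).
  assert (E : wallis (S k) = (2 * INR k + 2) / (2 * INR k + 3) * wallis k).
  { apply (Rmult_eq_reg_l (2 * INR k + 3)); [|lra]. rewrite wallis_rec. field. lra. }
  rewrite E. set (K := INR k) in *. set (w := wallis k).
  replace (((2 * K + 2) / (2 * K + 3) * w) ^ 2 * (K + 1) ^ 3 / (K + 1 - 3 / 8) ^ 2)
    with (w ^ 2 * ((2 * K + 2) ^ 2 * (K + 1) ^ 3 / ((2 * K + 3) ^ 2 * (K + 1 - 3 / 8) ^ 2)))
    by (field; lra).
  unfold Rdiv at 3. rewrite Rmult_assoc. apply Rmult_le_compat_l; [apply pow2_ge_0|].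
  assert (P1 : 0 < (2 * K + 3) ^ 2 * (K + 1 - 3 / 8) ^ 2)
    by (apply Rmult_lt_0_compat; apply pow_lt; lra).
  assert (P2 : 0 < (K - 3 / 8) ^ 2) by (apply pow_lt; lra).
  apply (Rmult_le_reg_r ((2 * K + 3) ^ 2 * (K + 1 - 3 / 8) ^ 2 * (K - 3 / 8) ^ 2));
    [now apply Rmult_lt_0_compat|].
  replace ((2 * K + 2) ^ 2 * (K + 1) ^ 3 / ((2 * K + 3) ^ 2 * (K + 1 - 3 / 8) ^ 2) *
     ((2 * K + 3) ^ 2 * (K + 1 - 3 / 8) ^ 2 * (K - 3 / 8) ^ 2))
    with ((2 * K + 2) ^ 2 * (K + 1) ^ 3 * (K - 3 / 8) ^ 2) by (field; lra).
  replace (K ^ 3 * / (K - 3 / 8) ^ 2 *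
     ((2 * K + 3) ^ 2 * (K + 1 - 3 / 8) ^ 2 * (K - 3 / 8) ^ 2))
    with (K ^ 3 * ((2 * K + 3) ^ 2 * (K + 1 - 3 / 8) ^ 2)) by (field; lra).
  (* The terms of degree 7, 6 and 5 cancel: this is why 3 / 8 is the right shift. *)
  apply Rminus_le_0.
  replace (K ^ 3 * ((2 * K + 3) ^ 2 * (K + 1 - 3 / 8) ^ 2) -
    (2 * K + 2) ^ 2 * (K + 1) ^ 3 * (K - 3 / 8) ^ 2)
    with ((200 * K ^ 4 + 505 * K ^ 3 + 344 * K ^ 2 + 12 * K - 36) / 64) by field.
  assert (1 <= K ^ 2) by nra. assert (1 <= K ^ 3) by (apply pow_R1_Rle; lra).
  assert (1 <= K ^ 4) by (apply pow_R1_Rle; lra). lra.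
Qed.

(** The ratio is decreasing, and by [wallis_sq_ge] it is at least
    [PI / 4 * (1 - 1 / n)] at the index [n + k]. *)
Lemma wallis_ratio_ge (k : nat) : (1 <= k)%nat -> PI / 4 <= wallis_ratio k.
Proof.
  intros Hk. apply (le_of_forall_div _ _ (PI / 4)). intros n Hn.
  assert (HP := PI_RGT_0).
  assert (D : wallis_ratio (n + k) <= wallis_ratio k).
  { clear Hn. induction n as [|n IH]; [apply Rle_refl|].
    eapply Rle_trans; [|exact IH]. apply wallis_ratio_decr. lia. }
  assert (HK : 1 <= INR (n + k)) by (apply (le_INR 1); lia).
  assert (Hn1 : 1 <= INR n) by (apply (le_INR 1); lia).
  assert (Hle : INR n <= INR (n + k)) by (apply le_INR; lia).
  assert (L : PI / 4 - PI / 4 / INR n <= wallis_ratio (n + k)).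
  { unfold wallis_ratio. assert (W := wallis_sq_ge (n + k)).
    set (K := INR (n + k)) in *. set (w := wallis (n + k) ^ 2) in *.
    assert (Hw : PI / (4 * (K + 1)) <= w).
    { apply (Rmult_le_reg_r (4 * (K + 1))); [lra|].
      replace (PI / (4 * (K + 1)) * (4 * (K + 1))) with PI by (field; lra). lra. }
    assert (Hw0 : 0 <= w) by apply pow2_ge_0.
    assert (H1 : w * K <= w * K ^ 3 / (K - 3 / 8) ^ 2).
    { assert (P2 : 0 < (K - 3 / 8) ^ 2) by (apply pow_lt; lra).
      apply (Rmult_le_reg_r ((K - 3 / 8) ^ 2)); [exact P2|].
      replace (w * K ^ 3 / (K - 3 / 8) ^ 2 * (K - 3 / 8) ^ 2) with (w * K * K ^ 2)
        by (field; lra).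
      apply Rmult_le_compat_l; [apply Rmult_le_pos; lra|nra]. }
    assert (H2 : PI / (4 * (K + 1)) * K <= w * K) by (apply Rmult_le_compat_r; lra).
    assert (H3 : PI / (4 * (K + 1)) * K = PI / 4 - PI / 4 * / (K + 1)) by (field; lra).
    assert (H4 : / (K + 1) <= / INR n) by (apply Rinv_le_contravar; lra).
    assert (H5 : PI / 4 * / (K + 1) <= PI / 4 * / INR n) by (apply Rmult_le_compat_l; lra).
    unfold Rdiv at 2. lra. }
  lra.
Qed.

Lemma le_of_sq_le (x y : R) : 0 <= y -> x ^ 2 <= y ^ 2 -> x <= y.
Proof. intros Hy H. apply Rnot_lt_le. intros L. nra. Qed.

Lemma wallis_lower (k : nat) : (1 <= k)%nat ->
  sqrt PI * (INR k - 3 / 8) / (2 * INR k * sqrt (INR k)) <= wallis k.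
Proof.
  intros Hk. assert (HK : 1 <= INR k) by (apply (le_INR 1); exact Hk).
  assert (HP := PI_RGT_0). assert (R := wallis_ratio_ge k Hk).
  apply le_of_sq_le; [apply wallis_nonneg|].
  unfold wallis_ratio in R. set (w := wallis k ^ 2) in *. set (K := INR k) in *.
  assert (S1 : sqrt PI ^ 2 = PI) by (apply pow2_sqrt; lra).
  assert (S2 : sqrt K ^ 2 = K) by (apply pow2_sqrt; lra).
  assert (0 < sqrt K) by (apply sqrt_lt_R0; lra).
  replace ((sqrt PI * (K - 3 / 8) / (2 * K * sqrt K)) ^ 2)
    with (sqrt PI ^ 2 * (K - 3 / 8) ^ 2 / (4 * K ^ 2 * sqrt K ^ 2)) by (field; lra).
  rewrite S1, S2.
  replace w with (w * K ^ 3 / (K - 3 / 8) ^ 2 * ((K - 3 / 8) ^ 2 / K ^ 3)) by (field; lra).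
  replace (PI * (K - 3 / 8) ^ 2 / (4 * K ^ 2 * K))
    with (PI / 4 * ((K - 3 / 8) ^ 2 / K ^ 3)) by (field; lra).
  apply Rmult_le_compat_r; [|exact R].
  apply Rlt_le, Rdiv_lt_0_compat; apply pow_lt; lra.
Qed.

(** * The Gaussian integral and the main estimate *)

(** The Gaussian is compared with a Wallis integrand of large exponent
    [m = k n^2]: since [k u^2 = m (u / n)^2], [gap_le] gives
    [exp (- k u^2) <= (1 - (u / n)^2)^m + k / n^2].  After rescaling [u] by [n], the
    first part integrates to at most [n * wallis m <= sqrt PI / (2 sqrt k)]. *)
Lemma gaussian_upper (k : nat) : (1 <= k)%nat ->
  RInt (fun u => exp (- (INR k * u ^ 2))) 0 1 <= sqrt PI / (2 * sqrt (INR k)).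
Proof.
  intros Hk. assert (HK : 1 <= INR k) by (apply (le_INR 1); exact Hk).
  assert (HP := PI_RGT_0).
  apply (le_of_forall_div _ _ (INR k)). intros n Hn.
  assert (Hn1 : 1 <= INR n) by (apply (le_INR 1); exact Hn).
  set (m := (k * (n * n))%nat).
  assert (Em : INR m = INR k * INR n ^ 2) by (unfold m; rewrite !mult_INR; ring).
  set (f := fun u => (1 - u ^ 2) ^ m).
  assert (Ef : ex_RInt (fun y => f (/ INR n * y + 0)) 0 1).
  { apply ex_RInt_of_ex_derive. intros x. unfold f. auto_derive. exact I. }
  assert (Step1 : RInt (fun u => exp (- (INR k * u ^ 2))) 0 1
     <= RInt (fun y => f (/ INR n * y + 0) + INR k / INR n) 0 1).
  { apply RInt_le; [lra|apply ex_RInt_exp_sq| |].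
    - apply (ex_RInt_plus (V := R_NormedModule)); [exact Ef|apply ex_RInt_const].
    - intros u Hu. unfold f. set (x := (/ INR n * u + 0) ^ 2).
      assert (Ex : x = u ^ 2 / INR n ^ 2) by (unfold x; field; lra).
      assert (Hi : 0 < / INR n <= 1).
      { split; [apply Rinv_0_lt_compat; lra|].
        rewrite <- Rinv_1. apply Rinv_le_contravar; lra. }
      assert (Hv : 0 <= / INR n * u + 0 <= 1).
      { assert (/ INR n * u <= 1 * 1) by (apply Rmult_le_compat; lra).
        assert (0 <= / INR n * u) by (apply Rmult_le_pos; lra). lra. }
      assert (Hx : 0 <= x <= 1).
      { unfold x. split; [apply pow_le; lra|].
        rewrite <- (pow1 2). apply pow_incr. exact Hv. }
      assert (G := gap_le m x Hx). unfold gap in G.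
      replace (INR m * x) with (INR k * u ^ 2) in G by (rewrite Em, Ex; field; lra).
      assert (E1 : exp (- (INR k * u ^ 2)) <= 1).
      { rewrite <- exp_0. apply Rnot_lt_le; intros L; apply exp_lt_inv in L. nra. }
      assert (E2 : 0 < exp (- (INR k * u ^ 2))) by apply exp_pos.
      assert (B : INR m * ((x ^ 2 + x ^ 3) / 2) <= INR k / INR n).
      { apply Rle_trans with (INR m * x ^ 2).
        - apply Rmult_le_compat_l; [apply pos_INR|]. nra.
        - rewrite Em, Ex.
          replace (INR k * INR n ^ 2 * (u ^ 2 / INR n ^ 2) ^ 2)
            with (INR k * (u ^ 4 * / INR n * / INR n)) by (field; lra).
          unfold Rdiv. apply Rmult_le_compat_l; [lra|].
          assert (0 <= u ^ 4 <= 1).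
          { split; [apply pow_le; lra|]. rewrite <- (pow1 4). apply pow_incr; lra. }
          rewrite <- (Rmult_1_l (/ INR n)) at 3. apply Rmult_le_compat_r; nra. }
      assert (B0 : 0 <= INR m * ((x ^ 2 + x ^ 3) / 2)).
      { apply Rmult_le_pos; [apply pos_INR|].
        assert (0 <= x ^ 2) by (apply pow_le; lra).
        assert (0 <= x ^ 3) by (apply pow_le; lra). lra. }
      assert (INR m * ((x ^ 2 + x ^ 3) / 2) * exp (- (INR k * u ^ 2))
              <= INR m * ((x ^ 2 + x ^ 3) / 2) * 1) by (apply Rmult_le_compat_l; lra).
      lra. }
  assert (Step2 : RInt (fun y => f (/ INR n * y + 0) + INR k / INR n) 0 1
     = INR n * RInt f 0 (/ INR n) + INR k / INR n).
  { rewrite (RInt_plus (V := R_CompleteNormedModule) (fun y => f (/ INR n * y + 0))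
               (fun _ => INR k / INR n))
      by (try exact Ef; apply ex_RInt_const).
    rewrite RInt_const.
    assert (L : / INR n * RInt (fun y => f (/ INR n * y + 0)) 0 1 = RInt f 0 (/ INR n)).
    { transitivity (RInt (V := R_CompleteNormedModule)
        (fun y => scal (/ INR n) (f (/ INR n * y + 0))) 0 1).
      - symmetry. exact (RInt_scal (V := R_CompleteNormedModule) _ _ _ (/ INR n) Ef).
      - rewrite (RInt_comp_lin (V := R_CompleteNormedModule) f) by apply ex_RInt_wallis.
        f_equal; ring. }
    rewrite <- L. change (RInt (fun y => f (/ INR n * y + 0)) 0 1 + (1 - 0) * (INR k / INR n)
      = INR n * (/ INR n * RInt (fun y => f (/ INR n * y + 0)) 0 1) + INR k / INR n).
    field. lra. }
  assert (Step3 : RInt f 0 (/ INR n) <= wallis m).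
  { assert (Hi : 0 < / INR n <= 1).
    { split; [apply Rinv_0_lt_compat; lra|].
      rewrite <- Rinv_1. apply Rinv_le_contravar; lra. }
    unfold wallis. fold f.
    rewrite (RInt_split f 0 (/ INR n) 1) by apply ex_RInt_wallis.
    assert (0 <= RInt f (/ INR n) 1).
    { apply RInt_ge_0; [lra|apply ex_RInt_wallis|].
      intros x Hx. apply pow_le. nra. }
    lra. }
  assert (HsK : 0 < sqrt (INR k)) by (apply sqrt_lt_R0; lra).
  assert (HsP : 0 < sqrt PI) by (apply sqrt_lt_R0; lra).
  assert (Step4 : wallis m <= sqrt PI / (2 * INR n * sqrt (INR k))).
  { assert (Hd : 0 < 2 * INR n * sqrt (INR k)) by (apply Rmult_lt_0_compat; lra).
    apply le_of_sq_le; [apply Rlt_le, Rdiv_lt_0_compat; assumption|].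
    replace ((sqrt PI / (2 * INR n * sqrt (INR k))) ^ 2)
      with (sqrt PI ^ 2 / (4 * INR n ^ 2 * sqrt (INR k) ^ 2)) by (field; lra).
    rewrite !pow2_sqrt by lra.
    assert (W := wallis_sq_le m). rewrite Em in W.
    assert (P4 : 0 < 4 * INR n ^ 2 * INR k) by nra.
    apply (Rmult_le_reg_r (4 * INR n ^ 2 * INR k)); [exact P4|].
    replace (PI / (4 * INR n ^ 2 * INR k) * (4 * INR n ^ 2 * INR k)) with PI by (field; lra).
    generalize (pow2_ge_0 (wallis m)). lra. }
  assert (Step5 : INR n * RInt f 0 (/ INR n) <= INR n * (sqrt PI / (2 * INR n * sqrt (INR k))))
    by (apply Rmult_le_compat_l; lra).
  replace (INR n * (sqrt PI / (2 * INR n * sqrt (INR k)))) with (sqrt PI / (2 * sqrt (INR k)))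
    in Step5 by (field; lra).
  lra.
Qed.

Lemma RInt_gap_sq_le (k : nat) : (1 <= k)%nat ->
  RInt (fun u => gap k (u ^ 2)) 0 1 <= 3 * sqrt PI / (16 * (INR k * sqrt (INR k))).
Proof.
  intros Hk. assert (HK : 1 <= INR k) by (apply (le_INR 1); exact Hk).
  assert (HsK : 0 < sqrt (INR k)) by (apply sqrt_lt_R0; lra).
  assert (E : RInt (fun u => gap k (u ^ 2)) 0 1
    = RInt (fun u => exp (- (INR k * u ^ 2))) 0 1 - wallis k).
  { apply (RInt_minus (V := R_CompleteNormedModule) (fun u => exp (- (INR k * u ^ 2)))
             (fun u => (1 - u ^ 2) ^ k)); [apply ex_RInt_exp_sq|apply ex_RInt_wallis]. }
  rewrite E. generalize (gaussian_upper k Hk) (wallis_lower k Hk). intros U L.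
  replace (3 * sqrt PI / (16 * (INR k * sqrt (INR k))))
    with (sqrt PI / (2 * sqrt (INR k)) - sqrt PI * (INR k - 3 / 8) / (2 * INR k * sqrt (INR k)))
    by (field; lra).
  lra.
Qed.

Theorem mainTheorem3 (k : nat) (hk : (1 <= k)%nat) :
  Rabs (Riesz (INR k) / INR k - c k) <=
    3 * sqrt PI / 16 * Rpower (INR k) (- (3 / 2))
    + 27 / 2 * exp (-3) * Rpower (INR k) (-2)
    + sqrt PI / 144 * Rpower (INR k) (- (5 / 2))
    + 128 * exp (-4) * Rpower (INR k) (-3).
Proof.
  assert (HK : 1 <= INR k) by (apply (le_INR 1); exact hk).
  assert (HsK : 0 < sqrt (INR k)) by (apply sqrt_lt_R0; lra).
  assert (P32 : Rpower (INR k) (- (3 / 2)) = / (INR k * sqrt (INR k))).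
  { rewrite Rpower_Ropp. f_equal. replace (3 / 2) with (1 + / 2) by field.
    rewrite Rpower_plus, Rpower_1, Rpower_sqrt by lra. reflexivity. }
  assert (P2 : Rpower (INR k) (-2) = / INR k ^ 2).
  { rewrite <- (Rpower_pow 2) by lra. rewrite <- Rpower_Ropp. f_equal; simpl; ring. }
  assert (P3 : Rpower (INR k) (-3) = / INR k ^ 3).
  { rewrite <- (Rpower_pow 3) by lra. rewrite <- Rpower_Ropp. f_equal; simpl; ring. }
  assert (P52 : 0 <= sqrt PI / 144 * Rpower (INR k) (- (5 / 2))).
  { apply Rmult_le_pos; [|apply Rlt_le, exp_pos]. generalize (sqrt_pos PI). lra. }
  rewrite P32, P2, P3.
  apply (le_of_forall_div _ _ (exp (INR k) + 2 ^ k)). intros N HN.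
  eapply Rle_trans; [apply (Riesz_c_le_psum k N hk HN)|].
  apply Rplus_le_compat_r.
  destruct N as [|N]; [lia|].
  eapply Rle_trans; [apply (psum_weighted_le k N hk)|].
  generalize (RInt_gap_sq_le k hk). unfold peak, Rdiv in *.
  rewrite Rinv_mult. lra.
Qed.
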